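(* If $T$ is a strongly connected tournament on $n\ge 3$ vertices, then $1\le\overrightarrow{rvc}(T)\le\overrightarrow{srvc}(T)\le n-2$.
   Context: A tournament is a digraph in which every two distinct vertices are joined by exactly one arc (in one direction). A (directed) path is a sequence of distinct vertices $x_0,\dots,x_\ell$ with each $x_{i-1}x_i$ an arc; its length is $\ell$. A digraph is strongly connected if for every ordered pair $(u,v)$ there is a $u$–$v$ path; a $u$–$v$ geodesic is a shortest $u$–$v$ path. In a vertex-coloured digraph, a path is rainbow if its internal vertices have pairwise distinct colours. A vertex-colouring of a strongly connected digraph $D$ is rainbow vertex-connected if every ordered pair $(u,v)$ is joined by a rainbow $u$–$v$ path, and strongly rainbow vertex-connected if every ordered pair is joined by a rainbow $u$–$v$ geodesic. $\overrightarrow{rvc}(D)$ (resp. $\overrightarrow{srvc}(D)$) is the minimum number of colours in a rainbow vertex-connected (resp. strongly rainbow vertex-connected) vertex-colouring of $D$. *)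

(* Defs.v *)
(* MathComp, with mathcomp.classical for minima over Prop-valued predicates. *)
From mathcomp Require Import all_boot.
From mathcomp Require Import boolp classical_sets.

Set Implicit Arguments.
Unset Strict Implicit.
Unset Printing Implicit Defensive.

Section Digraphs.
Variables (V : finType) (e : rel V).

Definition tournament : Prop :=
  irreflexive e /\ forall x y : V, x != y -> e x y (+) e y x.

(* The path is u :: p, so its length (number of arcs) is size p. *)
Definition dipath (u v : V) (p : seq V) : bool :=
  [&& path e u p, uniq (u :: p) & last u p == v].

Definition geodesic (u v : V) (p : seq V) : Prop :=
  dipath u v p /\ forall q : seq V, dipath u v q -> size p <= size q.

Definition strongly_connected : Prop :=
  forall u v : V, exists p : seq V, dipath u v p.

(* u :: p without its first and last vertices; empty if size p <= 1. *)
Definition internal (u : V) (p : seq V) : seq V := behead (belast u p).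

Section Colouring.
Variables (C : eqType) (c : V -> C).

Definition rainbow (u : V) (p : seq V) : bool := uniq (map c (internal u p)).

Definition rainbow_vertex_connected : Prop :=
  forall u v : V, exists p : seq V, dipath u v p /\ rainbow u p.

Definition strongly_rainbow_vertex_connected : Prop :=
  forall u v : V, exists p : seq V, geodesic u v p /\ rainbow u p.

End Colouring.

Definition is_least (P : nat -> Prop) (k : nat) : Prop :=
  P k /\ forall j : nat, P j -> k <= j.

(* The least k with P k; the junk value 0 if there is none. *)
Definition least (P : nat -> Prop) : nat := xget 0 [set k | is_least P k]%classic.

(* Colourings with k colours are maps to 'I_k, not required to be onto; this
   does not affect the minimum. *)
Definition rvc : nat :=
  least (fun k => exists c : V -> 'I_k, rainbow_vertex_connected c).

Definition srvc : nat :=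
  least (fun k => exists c : V -> 'I_k, strongly_rainbow_vertex_connected c).

End Digraphs.

Lemma leastP (P : nat -> Prop) : (exists k, P k) -> is_least P (least P).
Proof.
move=> [k Pk].
have exP : exists k, `[< P k >] by exists k; apply/asboolP.
have leastE : is_least P (ex_minn exP).
  case: ex_minnP => m /asboolP Pm minm; split=> // j Pj.
  by apply: minm; apply/asboolP.
exact: (xgetPex 0 (P := [set k | is_least P k]%classic) (ex_intro _ _ leastE)).
Qed.

Lemma dipath_geodesic (V : finType) (e : rel V) (u v : V) :
  (exists p, dipath e u v p) -> exists p, geodesic e u v p.
Proof.
move=> [p0 Hp0].
have [[p [Hp <-]] minp] : is_least (fun l => exists p, dipath e u v p /\ size p = l)
    (least (fun l => exists p, dipath e u v p /\ size p = l)).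
  by apply: leastP; exists (size p0), p0.
by exists p; split=> // q Hq; apply: minp; exists q.
Qed.

Lemma rainbow_inj (V : finType) (C : eqType) (c : V -> C) (u : V) (p : seq V) :
  injective c -> uniq (u :: p) -> rainbow c u p.
Proof.
move=> cI up; rewrite /rainbow map_inj_uniq //; case: p up => [//|x p].
by rewrite cons_uniq => /andP[_]; rewrite {1}lastI rcons_uniq => /andP[].
Qed.

Lemma srvcP (V : finType) (e : rel V) : strongly_connected e ->
  is_least (fun k => exists c : V -> 'I_k,
              strongly_rainbow_vertex_connected e c) (srvc e).
Proof.
move=> sc; apply: leastP; exists #|V|, (@enum_rank V) => u v.
have [p gp] := dipath_geodesic (sc u v); exists p; split=> //.
by case: gp => /and3P[_ up _] _; apply: rainbow_inj up; apply: enum_rank_inj.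
Qed.

Lemma rvcP (V : finType) (e : rel V) : strongly_connected e ->
  is_least (fun k => exists c : V -> 'I_k,
              rainbow_vertex_connected e c) (rvc e).
Proof.
move=> sc; apply: leastP; have [[c cP] _] := srvcP sc; exists (srvc e), c => u v.
by have [p [[pP _] rp]] := cP u v; exists p.
Qed.

(* Main.v *)
(** Let [d] be the distance of the tournament and call two vertices compatible
  if no geodesic has both of them as internal vertices.  It suffices to find
  two disjoint compatible pairs, or three pairwise compatible vertices: merging
  their colours in an injective colouring leaves [n - 2] colours.

  If [y] is a vertex farthest from [x] and [d x y >= 3], then [x] and [y] are
  compatible: on a geodesic, [x] cannot come before an internal [y] because the
  successor of [y] would be farther from [x]; if [y] came before [x], the
  successor [w] of [x] would satisfy [w -> y], whence [d x y <= 2].  The same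
  holds with the arcs reversed.  Let [x], [y] be at maximal distance [D].

  - If [D <= 2], geodesics have at most one internal vertex.
  - If [D >= 4], the second vertex of an [x]-[y] geodesic, with a vertex
    farthest from it, and dually the last but one vertex, provide two disjoint
    compatible pairs.
  - If [D = 3], all pairs at distance 3 are compatible.  Two disjoint ones, or
    three forming a triangle, suffice; otherwise they all share a vertex, [x]
    say, and then neither [x] nor [y] lies inside a geodesic of length 3, so
    that [x], [y] and any third vertex are pairwise compatible. *)
Require Import Defs.
From mathcomp Require Import all_boot.
From mathcomp Require Import zify.

Set Implicit Arguments.
Unset Strict Implicit.
Unset Printing Implicit Defensive.

(** * Distance in strongly connected digraphs *)

Section Dist.
Variables (V : finType) (e : rel V).

Definition dist (u v : V) : nat :=
  least (fun k => exists p, dipath e u v p /\ size p = k).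

Hypothesis sc : strongly_connected e.

Lemma distP u v : exists p, dipath e u v p /\ size p = dist u v.
Proof.
have [p pP] := sc u v.
have [] // := @leastP (fun k => exists p, dipath e u v p /\ size p = k).
by exists (size p), p.
Qed.

Lemma dist_dipath u v p : dipath e u v p -> dist u v <= size p.
Proof.
move=> pP.
have [|_] := @leastP (fun k => exists p, dipath e u v p /\ size p = k).
  by exists (size p), p.
by apply; exists p.
Qed.

(** A walk may repeat vertices, but it shortens to a path using only its own vertices. *)
Lemma dist_path u p : path e u p -> dist u (last u p) <= size p.
Proof.
case/shortenP=> q eq uq sq.
have := @dist_dipath u (last u q) q; rewrite /dipath eq uq eqxx => /(_ isT) le.
apply: leq_trans le _; apply: uniq_leq_size => //.
by case/andP: uq.
Qed.

Lemma dist_geodesic u v p : geodesic e u v p -> size p = dist u v.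
Proof.
case=> pP minp; have [q [qP sq]] := distP u v.
by have := dist_dipath pP; have := minp q qP; lia.
Qed.

Lemma dist_xx u : dist u u = 0.
Proof.
apply/eqP; rewrite -leqn0; apply: (@dist_dipath u u [::]).
by rewrite /dipath /= eqxx.
Qed.

Lemma dist0 u v : (dist u v == 0) = (u == v).
Proof.
apply/eqP/eqP=> [uv|->]; last exact: dist_xx.
by have [p [/and3P[_ _ /eqP pv]]] := distP u v; rewrite uv -pv => /size0nil ->.
Qed.

Lemma dist1 u v : irreflexive e -> (dist u v == 1) = e u v.
Proof.
move=> irr; apply/eqP/idP=> [uv|uv].
  have [p [/and3P[pe _ /eqP pv]]] := distP u v; rewrite uv.
  by case: p pe pv => [|x [|y p]] //= /andP[ux _] <-.
have := @dist_path u [:: v]; rewrite /= uv => /(_ isT) le.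
have : u != v by apply: contraTneq uv => ->; rewrite irr.
by rewrite -dist0; lia.
Qed.

Lemma dist_le_add v u w : dist u w <= dist u v + dist v w.
Proof.
have [p [/and3P[pe _ /eqP pv] <-]] := distP u v.
have [q [/and3P[qe _ /eqP qw] <-]] := distP v w.
have := @dist_path u (p ++ q).
by rewrite cat_path pe last_cat pv qw qe size_cat => /(_ isT).
Qed.

End Dist.

Lemma mem_internal (V : finType) (u : V) p x : uniq (u :: p) -> x \in internal u p ->
  [/\ x \in p, u != x & last u p != x].
Proof.
case: p => [//|y p]; rewrite cons_uniq => /andP[up uyp]; rewrite /internal /= => xp.
have xyp := mem_belast xp.
split=> //; first by apply: contraNneq up => ->.
apply: contraTneq xp => <-; move: uyp; rewrite lastI rcons_uniq.
by case/andP.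
Qed.

(** * Tournament distances and compatible vertices *)

Section TournamentDistance.
Variable V : finType.
Implicit Types (d : V -> V -> nat) (a b u v x y z : V).

(* [dist_last] is there to make the notion invariant under reversing the arcs. *)
Record tournament_dist d : Prop := TournamentDist {
  dist_eq0 : forall x y, (d x y == 0) = (x == y);
  dist_triangle : forall y x z, d x z <= d x y + d y z;
  dist_arc : forall x y, x != y -> (d x y == 1) (+) (d y x == 1);
  dist_first : forall x y, x != y -> exists z, d x z = 1 /\ d x y = (d z y).+1;
  dist_last : forall x y, x != y -> exists z, d z y = 1 /\ d x y = (d x z).+1
}.

Lemma tournament_dist_flip d :
  tournament_dist d -> tournament_dist (fun x y => d y x).
Proof.
case=> d0 dT d1 df dl; split=> [x y|y x z|x y xy|x y xy|x y xy].
- by rewrite d0 eq_sym.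
- by rewrite addnC.
- by rewrite addbC d1.
- by apply: dl; rewrite eq_sym.
- by apply: df; rewrite eq_sym.
Qed.

(* No geodesic has [a] and then [b] as internal vertices. *)
Definition not_through d a b : Prop :=
  forall u v, u != a -> v != b -> d u v < d u a + d a b + d b v.

Definition compatible d a b : Prop := not_through d a b /\ not_through d b a.

Lemma compatible_sym d a b : compatible d a b -> compatible d b a.
Proof. by case. Qed.

Lemma compatible_flip d a b :
  compatible (fun x y => d y x) a b -> compatible d a b.
Proof.
case=> ab ba; split=> u v ua vb.
  by have := ba v u vb ua; rewrite addnC [d b v + _]addnC addnA.
by have := ab v u vb ua; rewrite addnC [d a v + _]addnC addnA.
Qed.

Lemma compatible_farthest d x y : tournament_dist d ->
  3 <= d x y -> (forall z, d x z <= d x y) -> compatible d x y.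
Proof.
move=> [d0 dT d1 df dl] xy far; split=> u v ux vy.
  have := d0 u x; have := d0 y v; have := far v; have := dT x u v.
  rewrite (negPf ux) [y == v]eq_sym (negPf vy); lia.
have [w [xw xv]] : exists w, d x w = 1 /\ d x v = (d w v).+1.
  by apply: df; rewrite eq_sym.
have yw : y != w by apply/eqP=> yw; move: xy; rewrite yw; lia.
have yx : y != x by rewrite eq_sym -d0; lia.
(* An arc from [y] to [w] would shortcut the passage through [x]; an arc from [w] to [y] would give
   [d x y <= 2]. *)
have := dT w x y; have := dT y u v; have := dT w y v; have := d0 y x.
by have := d1 _ _ yw; rewrite (negPf yx); do 2!case: eqP => //; lia.
Qed.

Definition proper_colouring d k : Prop :=
  exists c : V -> 'I_k, forall a b, a != b -> c a = c b -> compatible d a b.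

(* For [a = a'] the colour class [{a, b, b'}] is a triple. *)
Lemma merge_colours d a b a' b' :
  b != b' -> a != b -> a != b' -> a' != b -> a' != b' ->
  compatible d a b -> compatible d a' b' ->
  (a = a' -> compatible d b b') -> proper_colouring d (#|V| - 2).
Proof.
move=> bb' ab ab' a'b a'b' cab ca'b' cbb'.
(* The colour of a vertex is its image under [f], which is never [b] or [b']. *)
pose f x := if x == b then a else if x == b' then a' else x.
have fP x : f x \in ~: [set b; b'].
  rewrite /f !inE negb_or; case: (eqVneq x b) => [_|xb]; first by rewrite ab ab'.
  by case: (eqVneq x b') => [_|xb']; rewrite ?a'b ?a'b' ?xb ?xb'.
have cardE : #|~: [set b; b']| = #|V| - 2 by rewrite cardsCs setCK cards2 bb'.
exists (fun x => cast_ord cardE (enum_rank_in (fP a) (f x))) => x y xy.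
move/cast_ord_inj/(enum_rank_in_inj (fP x) (fP y)).
have sym := @compatible_sym d; rewrite /f.
case: (eqVneq x b) => [xb|xb]; case: (eqVneq y b) => [yb|yb].
- by move: xy; rewrite xb yb eqxx.
- by subst x; case: (eqVneq y b') => [-> /cbb'|_ <-]; last exact: sym.
- by subst y; case: (eqVneq x b') => [-> /esym/cbb'/sym|_ ->].
- case: (eqVneq x b') => [xb'|_]; case: (eqVneq y b') => [yb'|_].
  + by move: xy; rewrite xb' yb' eqxx.
  + by move=> <-; rewrite xb'; apply: sym.
  + by move=> ->; rewrite yb'.
  + by move=> E; rewrite E eqxx in xy.
Qed.

Lemma proper_colouring_flip d k :
  proper_colouring (fun x y => d y x) k -> proper_colouring d k.
Proof. by case=> c cP; exists c => a b ab /(cP _ _ ab)/compatible_flip. Qed.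

(** * Colourings according to the diameter *)

Section Diameter.
Variable d : V -> V -> nat.
Hypothesis dP : tournament_dist d.

(** If [x], [a], [z] begin a geodesic to [y], then [z] has an arc to [x], so [d a x <= 2]. As
    [d a y >= 3], a vertex [b] farthest from [a] is not [x]. *)
Lemma compatible_second x y : 4 <= d x y -> (forall u v, d u v <= d x y) ->
  exists a b, [/\ d x a = 1, d x y = (d a y).+1, a != b, b != x & compatible d a b].
Proof.
move=> xy diam; have [d0 dT d1 df _] := dP.
have xNy : x != y by rewrite -d0; lia.
have [a [xa ay]] := df x y xNy.
have aNy : a != y by rewrite -d0; lia.
have [z [az zy]] := df a y aNy.
have zx : z != x by apply/eqP=> zx; move: zy; rewrite zx; lia.
have ax2 : d a x <= 2.
  have := dT z a x; have := d1 _ _ zx; have := dT z x y.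
  by case: eqP => [->|_]; last case: eqP => //; lia.
case: (arg_maxnP (d a) (erefl (predT y))) => b _ /(_ _ isT) far.
exists a, b; have aby := far y; split=> //.
- by rewrite -d0; lia.
- by apply/eqP=> bx; move: aby; rewrite bx; lia.
- by apply: compatible_farthest => //; lia.
Qed.

Lemma colouring_diameter3_star x y : d x y = 3 -> (forall u v, d u v <= 3) ->
  (forall u v, d u v = 3 -> u = x \/ v = x) -> 3 <= #|V| ->
  proper_colouring d (#|V| - 2).
Proof.
move=> xy diam star n3; have [d0 dT d1 _ _] := dP.
have xNy : x != y by rewrite -d0; lia.
have [z /andP[zx zy]] : exists z, (z != x) && (z != y).
  have : 0 < #|~: [set x; y]| by rewrite cardsCs setCK cards2 xNy; lia.
  by case/card_gt0P=> z; rewrite !inE negb_or => zP; exists z.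
have antisym u v : d u v = 1 -> d v u != 1.
  move=> uv; have uNv : u != v by rewrite -d0 uv.
  by have := d1 _ _ uNv; rewrite uv.
have arc u v : u != v -> d u v <> 1 -> d v u = 1.
  by move=> /d1; case: eqP => // _ /eqP.
(* Geodesics with two internal vertices [a], [b] have the form
   [u -> a -> b -> v]. *)
have notT a b : a != b ->
    (forall u v, d u v = 3 -> d u a = 1 -> d a b = 1 -> d b v = 1 -> False) ->
    not_through d a b.
  move=> ab H u v ua vb; rewrite ltnNge; apply/negP=> le.
  have := diam u v; have := d0 u a; have := d0 a b; have := d0 b v.
  rewrite (negPf ua) (negPf ab) [b == v]eq_sym (negPf vb) => *.
  by apply: (H u v); lia.
have compx b : b != x -> compatible d x b.
  move=> bx; split; apply: notT; rewrite // 1?eq_sym // => u v uv ua ab bv.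
    have [ux|vx] := star _ _ uv; subst; last by have := antisym _ _ ab; rewrite bv.
    by have := d0 x x; rewrite eqxx; lia.
  have [ux|vx] := star _ _ uv; subst; first by have := antisym _ _ ab; rewrite ua.
  by have := d0 x x; rewrite eqxx; lia.
(* If the geodesic starts at [x], then [y] inside it would be too close to [x]. If it ends at [x],
   the vertex before [y] has distance at least 2 to [x], hence receives an arc from [x], and again
   [d x y <= 2]. *)
have compy b : b != y -> compatible d y b.
  move=> by_; split; apply: notT; rewrite // 1?eq_sym // => u v uv ua ab bv.
    have [ux|vx] := star _ _ uv; subst; first by lia.
    have xu : d x u = 1 by apply: arc; rewrite -?d0; lia.
    by have := dT u x y; lia.
  have [ux|vx] := star _ _ uv; subst; first by have := dT b x y; lia.
  have bx2 : 2 <= d b x by have := dT b u x; lia.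
  have xb : d x b = 1 by apply: arc; rewrite -?d0; lia.
  by have := dT b x y; lia.
apply: (@merge_colours d x y x z); rewrite // 1?eq_sym //.
- by apply: compx; rewrite eq_sym.
- exact: compx.
- by move=> _; apply: compy.
Qed.

End Diameter.

Lemma tournament_colouring d : tournament_dist d -> 3 <= #|V| ->
  proper_colouring d (#|V| - 2).
Proof.
move=> dP n3; have [d0 _ _ _ _] := dP.
have [x0 _] : exists x0, x0 \in V by apply/card_gt0P; apply: leq_trans n3.
case: (arg_maxnP (fun p => d p.1 p.2) (erefl (predT (x0, x0)))) => -[x y] _ /= max.
have {}max u v : d u v <= d x y by apply: (max (u, v)).
have dflip := tournament_dist_flip dP.
case: (leqP (d x y) 2) => [le2|ge3].
  have n2 : 0 < #|V| - 2 by lia.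
  have nt a b : a != b -> not_through d a b.
    move=> ab u v ua vb; have := max u v.
    have := d0 u a; have := d0 a b; have := d0 b v.
    by rewrite (negPf ua) (negPf ab) [b == v]eq_sym (negPf vb); lia.
  exists (fun=> Ordinal n2) => a b ab _.
  by split; apply: nt => //; rewrite eq_sym.
have xNy : x != y by rewrite -d0; lia.
have yNx : y != x by rewrite eq_sym.
have cxy : compatible d x y by apply: compatible_farthest.
have [ge4|lt4] := ltnP 3 (d x y).
  have [a [b [xa ay ab bx cab]]] := compatible_second dP ge4 max.
  have [w [z [wy xw wz zy cwz]]] := compatible_second dflip ge4 (fun u v => max v u).
  have {}cwz := compatible_flip cwz.
  have ax : a != x by rewrite eq_sym -d0; lia.
  have aNy : a != y by rewrite -d0; lia.
  have wx : w != x by rewrite eq_sym -d0; lia.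
  have wNy : w != y by rewrite -d0; lia.
  (* The pair [a], [b] meets [x], [y] only if [b = y], and [w], [z] does only if [z = x]. If both
     happen, [a], [y] and [w], [x] are disjoint: [a] is at distance at least 3 from [y], and [w] at
     distance 1. *)
  case: (eqVneq b y) => [by_|by_].
    case: (eqVneq z x) => [zx|zx].
      subst; apply: (@merge_colours d a y w x) => // aw.
      by move: ay; rewrite aw; lia.
    apply: (@merge_colours d y x w z); rewrite // 1?eq_sym //.
    - exact: compatible_sym.
    - by move=> yw; rewrite yw eqxx in wNy.
  apply: (@merge_colours d x y a b); rewrite // 1?eq_sym //.
  by move=> xa'; rewrite xa' eqxx in ax.
have {ge3 lt4} xy3 : d x y = 3 by lia.
rewrite xy3 in max.
have comp3 u v : d u v = 3 -> compatible d u v.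
  by move=> uv; apply: compatible_farthest; rewrite ?uv.
case: (boolP [exists u, exists v, [&& d u v == 3, u \notin [:: x; y] & v \notin [:: x; y]]]).
  case/existsP=> u /existsP[v /and3P[/eqP uv]]; rewrite !inE !negb_or.
  move=> /andP[ux uy] /andP[vx vy].
  have uNv : u != v by rewrite -d0 uv.
  apply: (@merge_colours d x y u v); rewrite // 1?eq_sym //.
  - exact: comp3.
  - by move=> xu; rewrite xu eqxx in ux.
move=> nodisj.
have meet u v : d u v = 3 -> (u \in [:: x; y]) || (v \in [:: x; y]).
  move=> uv; apply: contraNT nodisj; rewrite negb_or => uvP.
  by apply/existsP; exists u; apply/existsP; exists v; rewrite uv.
have diag t : d t t = 3 -> False by have := d0 t t; rewrite eqxx; lia.
(* A pair at distance 3 that avoids [s] must contain [t]; its other vertex is [p]. *)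
have off s t : s != t -> (s, t) \in [:: (x, y); (y, x)] ->
    ~~ [forall u, forall v, (d u v == 3) ==> (u == s) || (v == s)] ->
    exists p, [/\ p != s, p != t & compatible d t p].
  move=> st stP /forallPn[u /forallPn[v]]; rewrite negb_imply negb_or.
  case/and3P=> /eqP uv us vs; have := meet u v uv.
  have memE r : (r \in [:: x; y]) = (r == s) || (r == t).
    by move: stP; rewrite !inE => /orP[] /eqP[-> ->] //; rewrite orbC.
  rewrite !memE (negPf us) (negPf vs) /= => /orP[] /eqP E; subst.
    exists v; split=> //; last exact: comp3.
    by apply/eqP=> E; subst; case: (diag t).
  exists u; split=> //; last exact/compatible_sym/comp3.
  by apply/eqP=> E; subst; case: (diag t).
have star s : [forall u, forall v, (d u v == 3) ==> (u == s) || (v == s)] ->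
    forall u v, d u v = 3 -> u = s \/ v = s.
  move=> /forallP H u v /eqP uv; have /forallP/(_ v)/implyP := H u.
  by move=> /(_ uv) /orP[] /eqP; [left|right].
have [/star sx|] := boolP [forall u, forall v, (d u v == 3) ==> (u == x) || (v == x)].
  exact: (colouring_diameter3_star dP xy3).
move/(off _ _ xNy); case; first by rewrite inE eqxx.
move=> p [px py cyp].
have [/star sy|] := boolP [forall u, forall v, (d u v == 3) ==> (u == y) || (v == y)].
  apply/proper_colouring_flip/(colouring_diameter3_star dflip xy3) => // u v vu.
  by case: (sy _ _ vu); [right|left].
move/(off _ _ yNx); case; first by rewrite !inE eqxx orbT.
move=> q [qy qx cxq].
(* Either [x], [y], [p] form a triangle, or [y], [p] and [x], [q] are disjoint pairs. *)
case: (eqVneq p q) => [pq|pq].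
  by subst; apply: (@merge_colours d x y x q); rewrite // 1?eq_sym.
apply: (@merge_colours d y p x q); rewrite // 1?eq_sym //.
by move=> yx; rewrite yx eqxx in yNx.
Qed.

End TournamentDistance.

(** * From compatible colour classes to rainbow geodesics *)

Section Bridge.
Variables (V : finType) (e : rel V).
Hypotheses (tour : tournament e) (sc : strongly_connected e).

Lemma tournament_distP : tournament_dist (dist e).
Proof.
have [irr tot] := tour; have d0 := dist0 sc; have dT := dist_le_add sc.
split=> // x y xy.
- by rewrite !(dist1 sc) // tot.
- have [p [pP sp]] := distP sc x y; have := d0 x y; rewrite (negPf xy) -sp.
  case: p pP sp => [//|z p] /and3P[/= /andP[xz pz] _ /eqP py] sp _.
  have xz1 : dist e x z = 1 by apply/eqP; rewrite dist1.
  exists z; split=> //; have := dist_path pz; rewrite py.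
  by have := dT z x y; lia.
- have [p [pP sp]] := distP sc x y; have := d0 x y; rewrite (negPf xy) -sp.
  case/lastP: p pP sp => [//|p z]; rewrite /dipath rcons_path last_rcons size_rcons.
  case/and3P=> /andP[px pz] _ /eqP zy; subst z => sp _.
  have zy1 : dist e (last x p) y = 1 by apply/eqP; rewrite dist1.
  exists (last x p); split=> //; have := dist_path px.
  by have := dT (last x p) x y; lia.
Qed.

(** The three stretches cut out by [a] and [b] bound the three distances, and their lengths add up
    to [dist e u v]. *)
Lemma geodesic_through u v p1 a p2 b p3 :
  geodesic e u v (p1 ++ a :: p2 ++ b :: p3) -> u != a -> v != b ->
  ~ not_through (dist e) a b.
Proof.
move=> g ua vb /(_ u v ua vb); have := dist_geodesic sc g.
case: g => /and3P[]; rewrite cat_path /= cat_path /= => /and5P[e1 e2 e3 e4 e5] _.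
rewrite !last_cat /= last_cat /= => /eqP pv _.
have := @dist_path _ e u (rcons p1 a); rewrite rcons_path e1 e2 => /(_ isT).
have := @dist_path _ e a (rcons p2 b); rewrite rcons_path e3 e4 => /(_ isT).
have := dist_path e5; rewrite pv !last_rcons.
by rewrite !(size_rcons, size_cat) /= size_cat /=; lia.
Qed.

Lemma strongly_rainbow_of_proper k (c : V -> 'I_k) :
  (forall a b, a != b -> c a = c b -> compatible (dist e) a b) ->
  strongly_rainbow_vertex_connected e c.
Proof.
move=> cP u v; have [p pP] := dipath_geodesic (sc u v); exists p; split=> //.
have /and3P[_ up /eqP lp] : dipath e u v p by case: pP.
rewrite /rainbow map_inj_in_uniq; last first.
  move=> a b /(mem_internal up)[ap ua]; rewrite lp => va.
  move=> /(mem_internal up)[bp ub]; rewrite lp => vb cab.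
  apply/eqP; apply: contraT => ab; have [ntab ntba] := cP _ _ ab cab.
  case/splitPr: ap pP bp {up lp} => p1 p2 pP.
  rewrite mem_cat inE eq_sym (negPf ab) /= => /orP[] bp.
    case/splitPr: bp pP => q1 q2; rewrite -catA cat_cons => pP.
    by case: (geodesic_through pP ub va).
  by case/splitPr: bp pP => q1 q2 pP; case: (geodesic_through pP ua vb).
(* It remains that the internal vertices are distinct, which is rainbowness for the identity
   colouring. *)
have := @rainbow_inj V V id u p (fun _ _ => id) up.
by rewrite /rainbow map_id.
Qed.

End Bridge.

Theorem theorem17 (V : finType) (e : rel V) :
  tournament e -> strongly_connected e -> 3 <= #|V| ->
  [/\ 1 <= rvc e, rvc e <= srvc e & srvc e <= #|V| - 2].
Proof.
move=> tour sc n3.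
have [[c _] rvc_min] := rvcP sc; have [[c' c'P] srvc_min] := srvcP sc.
split.
- have [x _] : exists x : V, x \in V by apply/card_gt0P; apply: leq_trans n3.
  (* The colour [c x] inhabits ['I_(rvc e)]. *)
  exact: leq_ltn_trans (leq0n _) (ltn_ord (c x)).
- apply: rvc_min; exists c' => u v; have [p [[pP _] rp]] := c'P u v.
  by exists p.
- apply: srvc_min.
  have [f fP] := tournament_colouring (tournament_distP tour sc) n3.
  by exists f; apply: strongly_rainbow_of_proper.
Qed.
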